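(* Let $d\ge 0$ and $l\ge1$ be integers, $\alpha_1,\dots,\alpha_d\in\mathbb{C}$, $\rho\in\mathbb{C}\setminus\{0\}$, $R(H)=\rho\prod_{j=1}^{d}(H+\alpha_j+1)$, and $G=R(H)\Delta$, where $H=-x\nabla$. Put $\eta=l^{d+1}\rho$ and $\eta_1=\frac{(-1)^{(d+1)l}\eta}{l}$. For $n\ge0$ let $P_n(x)=e^{G^l}\psi(x,n)$ with $\psi(x,n)=(-1)^n(-x)_n$. Then for every $n\ge 0$, as an identity of rational functions of $x$, $$P_n(x)=(-1)^n(-x)_n\;{}_{dl+l}F_l\left[\begin{matrix}\Delta(l;-n),\Delta(l;-n-\alpha_1),\dots,\Delta(l;-n-\alpha_d)\\ \Delta(l;x-n+1)\end{matrix};\eta_1^{\,l}\right].$$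
   Context: Operators act on $\mathbb{C}[x]$: $\Delta f(x)=f(x+1)-f(x)$, $\nabla f(x)=f(x-1)-f(x)$, $H=-x\nabla$. One has $\psi(x,n)=(-1)^n(-x)_n=x(x-1)\cdots(x-n+1)$, and $e^{G^l}\psi(x,n)=\sum_{j\ge0}\frac{G^{lj}\psi(x,n)}{j!}$ (a finite sum because $G$ lowers the degree). Pochhammer symbol: $(a)_0=1$, $(a)_j=a(a+1)\cdots(a+j-1)$. The symbol $\Delta(l;\lambda)$ (with two arguments, not to be confused with the difference operator $\Delta$) denotes the list of $l$ parameters $\frac{\lambda}{l},\frac{\lambda+1}{l},\dots,\frac{\lambda+l-1}{l}$. Generalized hypergeometric series: ${}_pF_q\left[\begin{matrix}a_1,\dots,a_p\\ b_1,\dots,b_q\end{matrix};z\right]=\sum_{j\ge0}\frac{(a_1)_j\cdots(a_p)_j}{(b_1)_j\cdots(b_q)_j}\frac{z^j}{j!}$; the series terminates because one element of $\Delta(l;-n)$ is a non-positive integer. *)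

(* Defs.v *)
From HB Require Import structures.
From mathcomp Require Import all_boot all_order all_algebra.
From mathcomp Require Import complex.
From mathcomp Require Import boolp classical_sets fsbigop reals.

Set Implicit Arguments.
Unset Strict Implicit.
Unset Printing Implicit Defensive.

Import GRing.Theory.

Notation "x %:F" := (FracField.tofrac x) : ring_scope.

Local Open Scope ring_scope.

Definition poch (A : nzRingType) (a : A) (n : nat) : A :=
  \prod_(i < n) (a + i%:R).

Section Operators.
Variable F : fieldType.
Implicit Types f : {poly F}.

Definition fdiff f : {poly F} := f \Po ('X + 1) - f.

(* Sign convention: f(x - 1) - f(x), not f(x) - f(x - 1). *)
Definition bdiff f : {poly F} := f \Po ('X - 1) - f.

Definition opH f : {poly F} := - 'X * bdiff f.

(* rho * (H + alpha_1 + 1) o ... o (H + alpha_d + 1) *)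
Definition opRH (d : nat) (alpha : 'I_d -> F) (rho : F) f : {poly F} :=
  rho *: (\big[(fun S T => S \o T)/id]_(j < d)
            (fun g : {poly F} => opH g + (alpha j + 1) *: g)) f.

Definition opG (d : nat) (alpha : 'I_d -> F) (rho : F) f : {poly F} :=
  opRH alpha rho (fdiff f).

(* The sum over all j >= 0 of T^j f / j!.  The sum over \in [set: nat] is the
   finitely supported one, so it has this meaning as soon as T is locally
   nilpotent. *)
Definition exp_op (T : {poly F} -> {poly F}) f : {poly F} :=
  \sum_(j \in [set: nat]%classic) (j`!%:R)^-1 *: iter j T f.

Definition psi (n : nat) : {poly F} := (-1) ^+ n * poch (- 'X) n.

End Operators.

Definition Delta_list (K : fieldType) (l : nat) (lambda : K) : seq K :=
  [seq (lambda + i%:R) / l%:R | i <- iota 0 l].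

(* A terminating series, with numerator parameters [as_] and denominator
   parameters [bs]; the sum over \in [set: nat] is finitely supported, and K
   may be a field without topology, such as a field of rational functions. *)
Definition pFq (K : fieldType) (as_ bs : seq K) (z : K) : K :=
  \sum_(j \in [set: nat]%classic)
    (\prod_(a <- as_) poch a j) / (\prod_(b <- bs) poch b j)
      * (z ^+ j / j`!%:R).

(* Main.v *)
Require Import Defs.
From mathcomp Require Import all_boot all_order all_algebra.
From mathcomp Require Import ring.
From mathcomp Require Import complex.
From mathcomp Require Import classical_sets functions fsbigop.
From mathcomp Require Import reals.
Import GRing.Theory.
Local Open Scope ring_scope.

(** The polynomials [psi n] form a ladder for the operators: [fdiff] sends
    [psi n] to [n psi (n - 1)], and [psi n] is an eigenvector of [opH] with
    eigenvalue [n]. So [opG] sends [psi n] to an explicit multiple of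
    [psi (n - 1)], and the accumulated factors of [opG ^ m] are Pochhammer
    symbols of length [m] ([iter_opG_psi]):
<<
      G^m psi n = ((-1)^(d+1) rho)^m (-n)_m prod_j (-n - alpha_j)_m psi (n - m)
>>
    In the exponential sum only [m = jl] occurs. The multiplication formula
    [poch_mul] turns each Pochhammer symbol of length [jl] into [l ^ (jl)] times
    the product over a parameter list [Delta(l; -)] of symbols of length [j], and
    [psi (n - jl)] is [psi n] divided by [(x - n + 1)_{jl}], which supplies the
    denominator parameters. The leftover signs and powers of [l] are those of
    [eta1 ^ (lj)] ([argument_expr]), so the exponential sum and the series agree
    term by term ([exp_term_pFq_term]). Both sums stop at [j = n], since
    [(-n)_{jl}] vanishes for [jl > n]. *)

(** * Pochhammer symbols *)

Lemma poch0 (A : nzRingType) (a : A) : poch a 0 = 1.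
Proof. by rewrite /poch big_ord0. Qed.

Lemma pochS (A : nzRingType) (a : A) m : poch a m.+1 = poch a m * (a + m%:R).
Proof. by rewrite /poch big_ord_recr. Qed.

Lemma pochD (A : nzRingType) (a : A) m k :
  poch a (m + k) = poch a m * poch (a + m%:R) k.
Proof.
rewrite /poch big_split_ord /=; congr (_ * _).
by apply: eq_bigr => i _; rewrite natrD addrA.
Qed.

Lemma pochSl (A : nzRingType) (a : A) m : poch a m.+1 = a * poch (a + 1) m.
Proof. by rewrite -add1n pochD pochS poch0 mul1r addr0. Qed.

Lemma rmorph_poch (A B : nzRingType) (f : {rmorphism A -> B}) a m :
  f (poch a m) = poch (f a) m.
Proof.
by rewrite /poch rmorph_prod; apply: eq_bigr => i _; rewrite rmorphD rmorph_nat.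
Qed.

Lemma poch_natN_eq0 (A : nzRingType) n m : (n < m)%N -> poch (- n%:R : A) m = 0.
Proof.
by move=> /subnKC <-; rewrite pochD pochS addNr mulr0 mul0r.
Qed.

(** Both sides are the falling factorial [a (a - 1) ... (a - m + 1)], read from
    opposite ends. *)
Lemma poch_reflect (A : comNzRingType) (a : A) m :
  (-1) ^+ m * poch (- a) m = poch (a - m%:R + 1) m.
Proof.
elim: m => [|m IH]; first by rewrite !poch0 mulr1.
rewrite [in RHS]pochSl -addn1 natrD.
have -> : a - (m%:R + 1) + 1 + 1 = a - m%:R + 1 by ring.
by rewrite -IH addn1 exprS pochS; ring.
Qed.

(** The multiplication formula that produces the parameter lists
    [Delta(l; lambda)]: the factors of [(lambda)_{lm}] are sorted by residue
    modulo [l], and each factor [lambda + i + lq] is [l] times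
    [(lambda + i) / l + q]. *)
Lemma poch_mul (K : fieldType) (l : nat) (lambda : K) m :
  l%:R != 0 :> K ->
  poch lambda (m * l) =
  l%:R ^+ (m * l) * \prod_(a <- Delta_list l lambda) poch a m.
Proof.
move=> l0; rewrite /Delta_list big_map.
have -> : iota 0 l = index_iota 0 l by rewrite /index_iota subn0.
rewrite big_mkord.
elim: m => [|m IH].
  by rewrite mul0n poch0 mul1r big1 // => i _; rewrite poch0.
rewrite mulSn addnC pochD IH exprD -!mulrA; congr (_ * _).
under [in RHS]eq_bigr do rewrite pochS.
rewrite big_split /= mulrCA; congr (_ * _).
have -> : l%:R ^+ l = \prod_(i < l) l%:R :> K by rewrite prodr_const card_ord.
rewrite /poch -big_split /=.
by apply: eq_bigr => i _; rewrite natrM; field.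
Qed.

(** * The operators on the basis of falling factorials *)

Lemma psiE (F : fieldType) n : psi F n = poch ('X - n%:R + 1) n.
Proof. by rewrite /psi poch_reflect. Qed.

Section Ladder.
Variable F : fieldType.

Lemma natr_scale k (p : {poly F}) : k%:R *: p = k%:R * p.
Proof. by rewrite scaler_nat mulr_natl. Qed.

Lemma fdiff_psi0 (c : F) : fdiff (c *: psi F 0) = 0.
Proof.
by rewrite /fdiff /psi poch0 mulr1 comp_polyZ -[1]/(1%:P) comp_polyC subrr.
Qed.

Lemma fdiff_psi (c : F) n :
  fdiff (c *: psi F n.+1) = (c * n.+1%:R) *: psi F n.
Proof.
rewrite /fdiff comp_polyZ -scalerBr -scalerA; congr (_ *: _).
rewrite !psiE (rmorph_poch _ _ (comp_poly ('X + 1))).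
rewrite !(rmorphD, rmorphN, rmorph_nat, rmorph1) /= comp_polyX.
have -> : 'X + 1 - n.+1%:R + 1 = 'X - n%:R + 1 :> {poly F}.
  by rewrite -natr1; ring.
have -> : 'X - n.+1%:R + 1 = 'X - n%:R :> {poly F}.
  by rewrite -natr1; ring.
by rewrite pochS pochSl natr_scale -natr1; ring.
Qed.

(** The products [x psi_n (x - 1)] and [(x - n) psi_n (x)] are both
    [x (x - 1) ... (x - n)]. *)
Lemma opH_psi (c : F) n : opH (c *: psi F n) = (c * n%:R) *: psi F n.
Proof.
rewrite /opH /bdiff comp_polyZ -scalerBr -scalerAr -scalerA; congr (_ *: _).
rewrite !psiE (rmorph_poch _ _ (comp_poly ('X - 1))).
rewrite !(rmorphD, rmorphN, rmorph_nat, rmorph1) /= comp_polyX.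
have -> : 'X - 1 - n%:R + 1 = 'X - n%:R :> {poly F} by ring.
have shift : poch ('X - n%:R) n * 'X
    = ('X - n%:R) * poch ('X - n%:R + 1) n :> {poly F}.
  by rewrite -pochSl pochS subrK.
by rewrite mulNr mulrBr [_ * poch _ n]mulrC shift natr_scale; ring.
Qed.

Lemma opRH_psi d (alpha : 'I_d -> F) rho c n :
  opRH alpha rho (c *: psi F n) =
  (c * rho * \prod_(j < d) (n%:R + alpha j + 1)) *: psi F n.
Proof.
have eigen : forall c : F,
    (\big[(fun S T => S \o T)/id]_(j < d)
       (fun g : {poly F} => opH g + (alpha j + 1) *: g)) (c *: psi F n)
    = (c * \prod_(j < d) (n%:R + alpha j + 1)) *: psi F n.
  elim/big_rec2: _ => [c'|j p T _ IH c']; first by rewrite mulr1.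
  by rewrite /= IH opH_psi scalerA -scalerDl; congr (_ *: _); ring.
by rewrite /opRH eigen scalerA; congr (_ *: _); ring.
Qed.

Lemma opG_psi0 d (alpha : 'I_d -> F) rho c : opG alpha rho (c *: psi F 0) = 0.
Proof.
by rewrite /opG fdiff_psi0 -(scale0r (psi F 0)) opRH_psi !mul0r.
Qed.

Lemma opG_psi d (alpha : 'I_d -> F) rho c n :
  opG alpha rho (c *: psi F n.+1) =
  (c * rho * n.+1%:R * \prod_(j < d) (n.+1%:R + alpha j)) *: psi F n.
Proof.
rewrite /opG fdiff_psi opRH_psi; congr (_ *: _).
rewrite -!mulrA; congr (_ * _); rewrite mulrCA; congr (_ * (_ * _)).
by apply: eq_bigr => j _; rewrite -natr1; ring.
Qed.

(** Each step of the ladder contributes one factor to each Pochhammer symbol, with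
    a sign for each of the [d + 1] of them: [n - m + a] is [- (- n - a + m)].
    For [m > n] the factor [(-n)_m] vanishes, so the truncated subtraction
    [n - m] is harmless. *)
Lemma iter_opG_psi d (alpha : 'I_d -> F) rho n m :
  iter m (opG alpha rho) (psi F n) =
  (((-1) ^+ d.+1 * rho) ^+ m * poch (- n%:R) m *
     \prod_(j < d) poch (- n%:R - alpha j) m) *: psi F (n - m).
Proof.
elim: m => [|m IH].
  by rewrite /= subn0 poch0 big1 ?mulr1 ?scale1r // => j _; rewrite poch0.
rewrite iterS IH.
have [lt_mn|le_nm] := ltnP m n; last first.
  have -> : (n - m = 0)%N by apply/eqP; rewrite subn_eq0.
  by rewrite opG_psi0 poch_natN_eq0 ?ltnS // mulr0 mul0r scale0r.
rewrite -[(n - m)%N](@ltn_predK 0) ?subn_gt0 // opG_psi -subnS; congr (_ *: _).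
have -> : (n - m.+1).+1%:R = n%:R - m%:R :> F by rewrite subnSK // natrB // ltnW.
under [in RHS]eq_bigr do rewrite pochS.
have -> : \prod_(j < d) (n%:R - m%:R + alpha j)
    = (-1) ^+ d * \prod_(j < d) (- n%:R - alpha j + m%:R) :> F.
  have -> : (-1) ^+ d = \prod_(j < d) (-1) :> F by rewrite prodr_const card_ord.
  rewrite -big_split /=.
  by apply: eq_bigr => j _; ring.
rewrite big_split /= pochS [in RHS](exprS _ m).
by move: (_ ^+ m) => u; rewrite (exprS (-1) d); ring.
Qed.

End Ladder.

(** * Comparison of the two sums *)

Lemma fsum_nat_bounded (V : nmodType) (f : nat -> V) N :
  (forall j, (N <= j)%N -> f j = 0) ->
  \sum_(j \in [set: nat]%classic) f j = \sum_(j < N) f j.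
Proof.
move=> f0; rewrite fsbig_ord; apply/esym/fsbig_widen => // j [_ /= /negP].
by rewrite -leqNgt => /f0.
Qed.

(** The denominator parameters of the series are transcendental, so none of its
    terms has a zero denominator. *)
Lemma poch_tofracX_neq0 (F : fieldType) (c : F) m :
  poch ('X + c%:P)%:F m != 0 :> {fraction {poly F}}.
Proof.
rewrite -rmorph_poch tofrac_eq0 /poch; apply/prodf_neq0 => i _.
by rewrite -polyC_natr -addrA -polyCD monic_neq0 ?monicXaddC.
Qed.

(** The signs match because [l ^ 2] and [l] have the same parity, and the powers
    of [l] are those that the multiplication formula for Pochhammer symbols
    leaves over. *)
Lemma argument_expr (F : fieldType) d l j (rho : F) : l%:R != 0 :> F ->
  (((-1) ^+ (d.+1 * l) * (l%:R ^+ d.+1 * rho) / l%:R) ^+ l) ^+ j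
  = ((-1) ^+ d.+1 * rho) ^+ (j * l) * (l%:R ^+ (j * l)) ^+ d.
Proof.
move=> l0.
have -> : (-1) ^+ (d.+1 * l) * (l%:R ^+ d.+1 * rho) / l%:R
    = (-1) ^+ (d.+1 * l) * rho * l%:R ^+ d :> F.
  by rewrite [l%:R ^+ d.+1]exprS; field.
rewrite -exprM [(l * j)%N]mulnC exprMn exprAC; congr (_ * _).
rewrite exprMn [RHS]exprMn -!exprM; congr (_ * _).
rewrite -signr_odd -[RHS]signr_odd; congr (_ ^+ nat_of_bool _).
by rewrite !oddM; case: (odd l); rewrite ?andbT ?andbF.
Qed.

Section Terms.
Variables (F K : fieldType) (emb : {rmorphism F -> K}).
Variables (d l : nat) (alpha : 'I_d -> F) (rho : F) (n : nat).
Hypothesis l_neq0 : l%:R != 0 :> F.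

Lemma numer_prod j :
  \prod_(a <- Delta_list l (- n%:R) ++
      flatten [seq Delta_list l (- n%:R - emb (alpha i)) | i <- enum 'I_d])
    poch a j
  = emb (poch (- n%:R) (j * l) * \prod_(i < d) poch (- n%:R - alpha i) (j * l)
         / (l%:R ^+ (j * l)) ^+ d.+1).
Proof.
have multisect (c : F) :
    \prod_(a <- Delta_list l (emb c)) poch a j
    = emb (poch c (j * l) / l%:R ^+ (j * l)).
  rewrite fmorph_div rmorphXn rmorph_nat rmorph_poch poch_mul; last first.
    by rewrite -(rmorph_nat emb) fmorph_eq0.
  by rewrite mulrC mulKf // expf_neq0 // -(rmorph_nat emb) fmorph_eq0.
have -> : - n%:R = emb (- n%:R) by rewrite rmorphN rmorph_nat.
rewrite big_cat big_flatten big_map big_enum /= multisect.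
under eq_bigr do rewrite -rmorphB multisect.
rewrite -rmorph_prod -rmorphM big_split /= prodr_const card_ord exprVn.
by rewrite exprS invfM; congr (emb _); ring.
Qed.

(** The coefficient on the left is that of [iter_opG_psi] divided by [j!], and the
    two rising factorials are the values of [psi (n - jl)] and [psi n] at [x].
    The top [jl] factors of
    [psi n] cancel the denominator Pochhammer symbols, which leaves
    [psi (n - jl)]. *)
Lemma exp_term_pFq_term (x : K) j :
  let eta1 := (-1) ^+ (d.+1 * l) * (l%:R ^+ d.+1 * rho) / l%:R in
  poch (x - n%:R + 1) (j * l) != 0 ->
  emb (j`!%:R^-1 *
        (((-1) ^+ d.+1 * rho) ^+ (j * l) * poch (- n%:R) (j * l) *
         \prod_(i < d) poch (- n%:R - alpha i) (j * l))) *
    poch (x - (n - j * l)%:R + 1) (n - j * l) =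
  poch (x - n%:R + 1) n *
    ((\prod_(a <- Delta_list l (- n%:R) ++
        flatten [seq Delta_list l (- n%:R - emb (alpha i)) | i <- enum 'I_d])
       poch a j) /
     (\prod_(b <- Delta_list l (x - n%:R + 1)) poch b j) *
     (emb (eta1 ^+ l) ^+ j / j`!%:R)).
Proof.
move=> eta1 denom_neq0; rewrite numer_prod.
have [lt_n|le_n] := ltnP n (j * l).
  by rewrite poch_natN_eq0 // !(mul0r, mulr0, rmorph0).
have split_n : poch (x - n%:R + 1) n
    = poch (x - n%:R + 1) (j * l) * poch (x - (n - j * l)%:R + 1) (n - j * l).
  rewrite -[in LHS](subnKC le_n) pochD subnKC //.
  by congr (_ * poch _ _); rewrite natrB //; ring.
have denom : poch (x - n%:R + 1) (j * l)
    = emb (l%:R ^+ (j * l)) * \prod_(b <- Delta_list l (x - n%:R + 1)) poch b j.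
  rewrite poch_mul ?rmorphXn ?rmorph_nat //.
  by rewrite -(rmorph_nat emb) fmorph_eq0.
move: denom_neq0; rewrite split_n denom mulf_eq0 negb_or => /andP[eL B0].
rewrite -rmorphXn argument_expr //.
move: (((-1) ^+ d.+1 * rho) ^+ _) (l%:R ^+ (j * l)) eL => u L eL.
move: (\prod_(b <- _) _) B0 => B B0.
rewrite !fmorph_div !rmorphM !rmorphXn !fmorphV !rmorph_nat exprS.
rewrite invfM.
have eLd : emb L ^+ d != 0 by rewrite expf_neq0.
by move: (emb L ^+ d) (j`!%:R^-1) eLd => Ld e eLd; field; apply/and3P.
Qed.

End Terms.

(** The argument is algebraic and divides by nothing in the base field but [l]:
    the inverses [1 / j!] occur identically on both sides. *)
Theorem exp_iter_opG_psi (F : fieldType) d l (alpha : 'I_d -> F) (rho : F) n :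
  l%:R != 0 :> F ->
  let eta1 := (-1) ^+ (d.+1 * l) * (l%:R ^+ d.+1 * rho) / l%:R in
  let x : {fraction {poly F}} := 'X%:F in
  (exp_op (iter l (opG alpha rho)) (psi F n))%:F =
    (-1) ^+ n * poch (- x) n *
    pFq (Delta_list l (- n%:R) ++
           flatten [seq Delta_list l (- n%:R - (alpha j)%:P%:F) | j <- enum 'I_d])
        (Delta_list l (x - n%:R + 1))
        ((eta1 ^+ l)%:P%:F).
Proof.
move=> l0 eta1 x.
have l_gt0 : (0 < l)%N by case: l l0 {eta1} => //; rewrite eqxx.
have lt_mul j : (n < j)%N -> (n < j * l)%N.
  by move=> lt_nj; apply: leq_trans lt_nj _; rewrite leq_pmulr.
pose emb : {rmorphism F -> {fraction {poly F}}} :=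
  (@FracField.tofrac {poly F} \o polyC)%FUN.
have embE (c : F) : c%:P%:F = emb c by [].
have denom_neq0 m : poch (x - n%:R + 1) m != 0.
  have -> : x - n%:R + 1 = ('X + (1 - n%:R)%:P)%:F.
    rewrite !(rmorphD, rmorphN, rmorph1, rmorph_nat) /=.
    by rewrite -addrA [1 + _]addrC addrA.
  exact: poch_tofracX_neq0.
clearbody emb.
have -> : [seq Delta_list l (- n%:R - (alpha j)%:P%:F) | j <- enum 'I_d]
    = [seq Delta_list l (- n%:R - emb (alpha j)) | j <- enum 'I_d].
  by apply: eq_map => j; rewrite embE.
rewrite [(eta1 ^+ l)%:P%:F]embE.
rewrite /exp_op /pFq !(@fsum_nat_bounded _ _ n.+1); last 2 first.
- move=> j lt_nj; rewrite (numer_prod _ _ emb) // poch_natN_eq0 ?lt_mul //.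
  by rewrite !mul0r rmorph0 !mul0r.
- move=> j lt_nj; rewrite -iterM iter_opG_psi poch_natN_eq0 ?lt_mul //.
  by rewrite mulr0 mul0r scale0r scaler0.
rewrite rmorph_sum mulr_sumr; apply: eq_bigr => [[j /= _] _].
rewrite poch_reflect -iterM iter_opG_psi scalerA -mul_polyC rmorphM /= embE.
rewrite psiE rmorph_poch !(rmorphD, rmorphN, rmorph1, rmorph_nat).
exact: exp_term_pFq_term.
Qed.

Theorem theorem3p9 (R : realType) (d l : nat) (hl : (1 <= l)%N)
    (alpha : 'I_d -> R[i]) (rho : R[i]) (hrho : rho != 0) (n : nat) :
  let G := opG alpha rho in
  let eta := l%:R ^+ d.+1 * rho in
  let eta1 := (-1) ^+ (d.+1 * l) * eta / l%:R in
  let P := exp_op (iter l G) (psi R[i] n) in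
  let x : {fraction {poly R[i]}} := 'X%:F in
  P%:F =
    (-1) ^+ n * poch (- x) n *
    pFq (Delta_list l (- n%:R) ++
           flatten [seq Delta_list l (- n%:R - (alpha j)%:P%:F) | j <- enum 'I_d])
        (Delta_list l (x - n%:R + 1))
        ((eta1 ^+ l)%:P%:F).
Proof. by apply: exp_iter_opG_psi; rewrite Num.Theory.pnatr_eq0 -lt0n. Qed.
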